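(* Let $X$ be a locally compact Polish space. Then $E^C_X \leq_B E_1$.
   Context: A continuum is a nonempty compact connected metrizable space (single points are continua). The continuum-connection relation $E_X^C$ on $X$ is $x\,E_X^C\,y$ iff there is a continuum in $X$ containing $x$ and $y$. The relation $E_1$ on $2^{\mathbb{N}\times\mathbb{N}}$ is defined by $xE_1y \iff \exists m\ \forall n\ge m\ \forall k\ x(n,k)=y(n,k)$. For equivalence relations $E,F$ on standard Borel spaces $X,Y$, $E\leq_B F$ means that there is a Borel map $f:X\to Y$ with $xEy\iff f(x)Ff(y)$ for all $x,y\in X$. *)

(* Defs.v *)
From HB Require Import structures.
From mathcomp Require Import all_boot all_order all_algebra.
From mathcomp Require Import all_classical all_reals all_analysis.

Set Implicit Arguments.
Unset Strict Implicit.
Unset Printing Implicit Defensive.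

Import Order.TTheory GRing.Theory Num.Theory.

Local Open Scope classical_set_scope.
Local Open Scope ring_scope.

Section Metrizability.
Variables (R : realType) (T : topologicalType).
Implicit Type d : T -> T -> R.

Definition is_metric d :=
  [/\ forall x y, 0 <= d x y,
      forall x y, d x y = 0 <-> x = y,
      forall x y, d x y = d y x &
      forall x y z, d x z <= d x y + d y z].

Definition compatible_metric d :=
  is_metric d /\
  forall U : set T, open U <->
    (forall x, U x -> exists2 e : R, 0 < e & [set y | d x y < e] `<=` U).

Definition complete_metric d :=
  forall u : nat -> T,
    (forall e : R, 0 < e -> exists N : nat, forall m n : nat,
       (N <= m)%N -> (N <= n)%N -> d (u m) (u n) < e) ->
    exists l : T, forall e : R, 0 < e -> exists N : nat, forall n : nat,
       (N <= n)%N -> d (u n) l < e.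

Definition metrizable := exists d, compatible_metric d.

Definition completely_metrizable :=
  exists d, compatible_metric d /\ complete_metric d.

Definition separable := exists D : set T, countable D /\ dense D.

(* The empty space is Polish. *)
Definition polish := separable /\ completely_metrizable.

Definition continuum :=
  [/\ [set: T] !=set0, compact [set: T], connected [set: T] & metrizable].

End Metrizability.

Arguments metrizable R T : clear implicits.
Arguments completely_metrizable R T : clear implicits.
Arguments separable T : clear implicits.
Arguments polish R T : clear implicits.
Arguments continuum R T : clear implicits.

(* [set_type K] is the subset K as a space, with the subspace topology. *)
Definition continuum_connection (R : realType) (X : topologicalType)
    (x y : X) : Prop :=
  exists K : set X, [/\ continuum R (set_type K), K x & K y].

Definition cantor_NN : Type := prod_topology (fun _ : nat * nat => bool).

HB.instance Definition _ := Topological.on cantor_NN.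

Definition E_1 (x y : cantor_NN) : Prop :=
  exists m : nat, forall n : nat, (m <= n)%N ->
    forall k : nat, x (n, k) = y (n, k).

Definition borel_set (T : topologicalType) (A : set T) : Prop :=
  <<s @open T >> A.

Definition borel_map (T U : topologicalType) (f : T -> U) : Prop :=
  forall B : set U, borel_set B -> borel_set (f @^-1` B).

Definition borel_reducible (T U : topologicalType)
    (E : T -> T -> Prop) (F : U -> U -> Prop) : Prop :=
  exists2 f : T -> U, borel_map f & forall x y : T, E x y <-> F (f x) (f y).

(* Main.v *)
(** Exhaust [X] by an increasing sequence of compact sets [K n] such that every
compact subset of [X] lies in some [K n]. In a compact metrizable space the
quasi-component of a point is connected, so [x] and [y] lie in a common
continuum iff, for some [n], both belong to [K n] and no relatively clopen
subset of [K n] separates them; if this holds at [n], it holds at every later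
index. Each [K n] has only countably many relatively clopen subsets
[A (n, k)], all closed in [X], so [x |-> ((n, k) |-> x \in A (n, k))] is Borel
and reduces the continuum-connection relation to [E_1]: rows [n] of the images
of [x, y \in K n] agree iff [x] and [y] share a quasi-component of [K n]. *)

From HB Require Import structures.
Require Import Defs.
From mathcomp Require Import all_boot all_order all_algebra.
From mathcomp Require Import all_classical all_reals all_analysis.
From mathcomp Require Import zify.

Set Implicit Arguments.
Unset Strict Implicit.
Unset Printing Implicit Defensive.

Import Order.TTheory GRing.Theory Num.Theory.

Local Open Scope classical_set_scope.
Local Open Scope ring_scope.

(** * Separation, countable bases and subspaces from a compatible metric *)

Section MetricTopology.
Variables (R : realType) (X : topologicalType) (d : X -> X -> R).
Hypothesis dX : compatible_metric d.

Let dxx x : d x x = 0.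
Proof. by have [[_ d0 _ _] _] := dX; apply/d0. Qed.

Let dC x y : d x y = d y x.
Proof. by have [[_ _ + _] _] := dX; apply. Qed.

Let dD y x z : d x z <= d x y + d y z.
Proof. by have [[_ _ _ +] _] := dX; apply. Qed.

Lemma open_metric_ball x e : open [set y | d x y < e].
Proof.
have [_ ->] := dX => y /= xy; exists (e - d x y); first by rewrite subr_gt0.
by move=> z /=; rewrite ltrBrDl; apply: le_lt_trans; exact: dD.
Qed.

Lemma nbhs_metric_ball x e : 0 < e -> nbhs x [set y | d x y < e].
Proof.
move=> e0; apply: open_nbhs_nbhs; split; first exact: open_metric_ball.
by rewrite /= dxx.
Qed.

Lemma nbhs_metricP x U : nbhs x U ->
  exists2 e, 0 < e & [set y | d x y < e] `<=` U.
Proof.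
rewrite nbhsE => -[W [oW Wx] WU]; have [_ opE] := dX.
by have [e e0 eW] := (opE W).1 oW x Wx; exists e => //; exact: subset_trans WU.
Qed.

Lemma compatible_metric_hausdorff : hausdorff_space X.
Proof.
move=> p q pq; have [[d0 dE _ _] _] := dX.
apply/dE/eqP; rewrite eq_le d0 andbT leNgt; apply/negP => dpq.
have h : 0 < d p q / 2 by rewrite divr_gt0.
have [z [/= pz qz]] := pq _ _ (nbhs_metric_ball p h) (nbhs_metric_ball q h).
have := dD z p q; rewrite leNgt => /negP; apply.
by rewrite (dC z q) (splitr (d p q)) ltrD.
Qed.

(** [hull P Q] collects the balls around points of [P] whose doubled ball misses [Q]. If balls of
    radii [r] and [s] around [a] and [b] met, the distance from [a] to [b] would be below twice the
    larger radius, so one doubled ball would contain the other centre. *)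
Lemma compatible_metric_normal (A B : set X) :
    closed A -> closed B -> A `&` B = set0 ->
  exists U V, [/\ open U, open V, A `<=` U, B `<=` V & U `&` V = set0].
Proof.
pose hull (P Q : set X) := \bigcup_(u in [set u : X * R | [/\ P u.1, 0 < u.2 &
  [set y | d u.1 y < u.2 *+ 2] `&` Q = set0]]) [set y | d u.1 y < u.2].
have hull_open P Q : open (hull P Q).
  by apply: bigcup_open => u _; exact: open_metric_ball.
have hull_sub P Q : closed Q -> P `&` Q = set0 -> P `<=` hull P Q.
  move=> cQ PQ0 x Px.
  have [e e0 eQ] : exists2 e, 0 < e & [set y | d x y < e] `<=` ~` Q.
    apply: nbhs_metricP; apply: open_nbhs_nbhs; split; first by rewrite openC.
    by move=> Qx; rewrite -[False]/(set0 x) -PQ0.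
  exists (x, e / 2) => /=; last by rewrite dxx divr_gt0.
  split=> //=; first by rewrite divr_gt0.
  by rewrite mulr2n -splitr; exact/disjoints_subset.
move=> cA cB AB0; exists (hull A B), (hull B A); split => //.
- exact: hull_sub.
- by apply: hull_sub; rewrite // setIC.
- rewrite -subset0 => z.
  move=> [[[a r] /= [Aa r0 aB]] az [[b s] /= [Bb s0 bA]] bz].
  have ab : d a b < r + s.
    by apply: le_lt_trans (dD z a b) _; rewrite (dC z b) ltrD.
  have [rs|sr] := leP r s.
    rewrite -[False]/(set0 a) -bA; split=> //=.
    rewrite dC; apply: lt_le_trans ab _.
    by rewrite mulr2n lerD2r.
  rewrite -[False]/(set0 b) -aB; split=> //=; apply: lt_le_trans ab _.
  by rewrite mulr2n lerD2l ltW.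
Qed.

Lemma separable_metric_base : separable X ->
  exists2 B : nat * nat -> set X, forall i, open (B i) &
    forall x U, nbhs x U -> exists2 i, B i x & B i `<=` U.
Proof.
move=> [D [/countable_injP[f finj] Ddense]].
(* As [f] is injective on [D], each of these unions is a single ball or empty. *)
exists (fun i => \bigcup_(z in [set z | D z /\ f z = i.1])
                 [set y | d z y < i.2.+1%:R^-1]).
  by move=> i; apply: bigcup_open => z _; exact: open_metric_ball.
move=> x U /nbhs_metricP[e e0 eU].
have e20 : 0 < e / 2 by rewrite divr_gt0.
have [k ke] := ltr_add_invr e20; rewrite add0r in ke.
have k0 : (0 : R) < k.+1%:R^-1 by rewrite invr_gt0 ltr0n.
have [z [/= xz Dz]] : [set y | d x y < k.+1%:R^-1] `&` D !=set0.
  by apply: Ddense; [exists x => /=; rewrite dxx|exact: open_metric_ball].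
exists (f z, k); first by exists z => //=; rewrite dC.
move=> y [z' /= [Dz' fz'] z'y]; move: z'y.
have -> : z' = z by apply: finj; rewrite ?inE.
move=> zy; apply: eU => /=; apply: le_lt_trans (dD z x y) _.
by rewrite (splitr e) ltrD //; [exact: lt_trans ke|exact: lt_trans ke].
Qed.

Lemma set_type_metrizable (K : set X) : metrizable R (set_type K).
Proof.
have [[d0 dE _ _] opE] := dX.
exists (fun x y => d (set_val x) (set_val y)); split.
  split=> [x y|x y|x y|x y z]; [exact: d0| |exact: dC|exact: dD].
  by rewrite dE; split=> [/val_inj|->].
move=> U; split=> [[W oW <-] x /= Wx|UP].
  have [e e0 eW] := (opE W).1 oW _ Wx; exists e => // y /=; exact: eW.
(* The open set of [X] with trace [U] is the union of all balls of [X] centred in [U] whose trace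
   lies in [U]. *)
exists (\bigcup_(u in [set u : K * R | U u.1 /\
  [set y | d (set_val u.1) (set_val y) < u.2] `<=` U])
  [set y | d (set_val u.1) y < u.2]).
  by apply: bigcup_open => u _; exact: open_metric_ball.
apply/seteqP; split=> x /=; first by move=> [u /= [_ +]]; apply.
by move=> Ux; have [e e0 eU] := UP x Ux; exists (x, e) => //=; rewrite dxx.
Qed.

End MetricTopology.

(** * Compactness, connectedness of subspaces, and compact exhaustions *)

Lemma compact_seq_cover (X : topologicalType) (I : choiceType) (A : set X)
    (U : I -> set X) :
  compact A -> (forall i, open (U i)) -> A `<=` \bigcup_i U i ->
  exists s : seq I, A `<=` \bigcup_(i in [set` s]) U i.
Proof.
move=> cA oU AU; have [A0|] := eqVneq A set0; first by exists [::]; rewrite A0.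
(* The cover form of compactness is applied to a pointed space, so a point of the nonempty [A]
   serves as base point. *)
move=> /set0P[x0 _].
pose P := isPointed.Build X x0.
pose pX : ptopologicalType := HB.pack (X : Type) P (Topological.class X).
have : @cover_compact pX A by rewrite -compact_cover.
move=> /(_ I setT U (fun i _ => oU i) AU)[s _ As].
by exists (finmap.enum_fset s).
Qed.

Lemma image_set_val (T : Type) (K : set T) :
  [set set_val x | x in [set: set_type K]] = K.
Proof.
apply/seteqP; split=> [_ [x _ <-]|x Kx]; first exact: set_valP.
by exists (SigSub (mem_set Kx)).
Qed.

(** In one direction [K] is the continuous image of its subspace. In the other, a filter is pushed
    forward along [set_val] and its cluster point in [K] is lifted back. *)
Lemma set_type_compactP (X : topologicalType) (K : set X) :
  compact [set: set_type K] <-> compact K.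
Proof.
split=> [cK|cK F FF _].
  rewrite -(image_set_val K); apply: continuous_compact => //.
  by apply: continuous_subspaceT; exact: initial_continuous.
have [|p [Kp pF]] := cK (set_val @ F).
  by apply: (@filterE _ F) => x; exact: set_valP.
exists (SigSub (mem_set Kp)); split=> // A B FA [_ [[W oW <-] Wp] WB].
have [||_ [[y Ay <-] Wy]] := pF (set_val @` A) W.
- by apply: (@filterS _ F _ A) => // x Ax; exists x.
- exact: open_nbhs_nbhs.
- by exists y; split=> //; exact: WB.
Qed.

Lemma set_type_connectedP (X : topologicalType) (K : set X) :
  connected [set: set_type K] <-> connected K.
Proof.
split=> [cK|cK B [b Bb] [C oC BC] [D cD BD]].
  rewrite -(image_set_val K); apply: connected_continuous_connected => //.
  by apply: continuous_subspaceT; exact: initial_continuous.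
rewrite setTI in BC; rewrite setTI in BD; subst C.
have [W oW WB] := oC.
have [F oF FB] := closed_openC cD.
(* [B] is the trace of the open [W] and also of the closed complement of [F], so connectedness of
   [K] applies to this common trace. *)
have KWF : K `&` W = K `&` ~` F.
  apply/seteqP; split=> x [Kx] Wx; split => //;
    pose k : K := SigSub (mem_set Kx).
    move=> Fx; have : (~` D) k by rewrite -FB.
    by apply; rewrite -BD -WB.
  have : B k; last by rewrite -WB.
  rewrite BD; apply: contrapT => nDk; apply: Wx.
  by rewrite -[F x]/((set_val @^-1` F) k) FB.
have KW : K `&` W = K.
  apply: cK.
  - by exists (set_val b); split; [exact: set_valP|rewrite -WB in Bb].
  - by exists W.
  - by exists (~` F) => //; exact: open_closedC.
apply/seteqP; split=> // x _; rewrite -WB.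
by have [] : (K `&` W) (set_val x) by rewrite KW; exact: set_valP.
Qed.

(** By local compactness the basic sets contained in a compact set cover [X], so finitely many of
    them cover a given compact [C]. Choosing one compact set for each such basic set and taking
    finite unions along the codes gives [K]. *)
Lemma compact_exhaustion (X : topologicalType) (I : countType)
    (B : I -> set X) :
    (forall i, open (B i)) ->
    (forall x U, nbhs x U -> exists2 i, B i x & B i `<=` U) ->
    locally_compact [set: X] ->
  exists K : nat -> set X, [/\ forall n, compact (K n),
    {homo K : m n / (m <= n)%N >-> m `<=` n} &
    forall C, compact C -> exists n, C `<=` K n].
Proof.
move=> oB baseB lcX.
pose good i := exists2 C, compact C & B i `<=` C.
have /choice[L LP] i : exists C, compact C /\ (good i -> B i `<=` C).
  have [[C cC BC]|ngood] := pselect (good i); first by exists C.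
  by exists set0; split=> //; exact: compact0.
pose L' j := oapp L set0 (unpickle j).
exists (fun n => \big[setU/set0]_(j < n) L' j); split.
- move=> n; apply: bigsetU_compact => j _; rewrite /L'.
  by case: unpickle => [i|] /=; [case: (LP i)|exact: compact0].
- by move=> m n mn; exact: subset_bigsetU.
- move=> C cC; pose U i := if `[< good i >] then B i else set0.
  have [||s Cs] := @compact_seq_cover X I C U cC.
  + by move=> i; rewrite /U; case: ifP => // _; exact: open0.
  + move=> x _; have [V] := lcX x Logic.I.
    move=> nV [cV _]; have /baseB[i Bix BV] : nbhs x V.
      by rewrite /within /= in nV; apply: filterS nV => z; exact.
    by exists i => //; rewrite /U asboolT //; exists V.
  (* [K n] collects the codes strictly below [n], hence the successor of the largest code in [s]. *)
  + exists (\max_(i <- s) pickle i).+1 => x /Cs[i /= si]; rewrite /U.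
    case: asboolP => // gi Bix.
    apply: (@bigsetU_sup _ (pickle i)); first by rewrite ltnS leq_bigmax_seq.
    by rewrite /L' pickleK /=; case: (LP i) => _; exact.
Qed.

(** * Relatively clopen subsets *)

(** For closed [K] these are the clopen subsets of the subspace [K], expressed by closedness in [X]
    so that different sets [K] can be compared. *)
Definition relatively_clopen (X : topologicalType) (K C : set X) :=
  [/\ C `<=` K, closed C & closed (K `\` C)].

Section RelativelyClopen.
Variable X : topologicalType.
Implicit Types K C S : set X.

Lemma relatively_clopenT K : closed K -> relatively_clopen K K.
Proof. by move=> cK; split=> //; rewrite setDv; exact: closed0. Qed.

Lemma relatively_clopen0 K : closed K -> relatively_clopen K set0.
Proof. by move=> cK; split=> //; [exact: closed0|rewrite setD0]. Qed.

Lemma relatively_clopenD K C :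
  relatively_clopen K C -> relatively_clopen K (K `\` C).
Proof. by move=> [CK cC cKC]; split=> //; rewrite setDD setIidr. Qed.

Lemma relatively_clopenI K C S :
  relatively_clopen K C -> relatively_clopen K S ->
  relatively_clopen K (C `&` S).
Proof.
move=> [CK cC cKC] [SK cS cKS]; split; first by apply: subIset; left.
- exact: closedI.
- by rewrite setDIr; exact: closedU.
Qed.

(** This is why points of one stage of an exhaustion that are not separated there remain unseparated
    at later stages. *)
Lemma relatively_clopen_sub K C S : closed S -> S `<=` K ->
  relatively_clopen K C -> relatively_clopen S (S `&` C).
Proof.
move=> cS SK [CK cC cKC]; split=> //; first exact: closedI.
rewrite (_ : _ `\` _ = S `&` (K `\` C)); first exact: closedI.
apply/seteqP; split=> x [Sx].
  by move=> nSC; split=> //; split; [exact: SK|move=> Cx; apply: nSC].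
by move=> [_ nCx]; split=> // -[].
Qed.

(** On [S], the closed set [C] has the same trace as the open complement of the rest of [K]; being
    nonempty, this trace is all of [S]. *)
Lemma connected_relatively_clopen K C S x y : S `<=` K -> connected S ->
  relatively_clopen K C -> S x -> S y -> C x -> C y.
Proof.
move=> SK cS [_ cC cKC] Sx Sy Cx.
suff SC : S `&` C = S by move: Sy; rewrite -SC => -[].
apply: cS; [by exists x| |by exists C].
exists (~` (K `\` C)); first exact: closed_openC.
apply/seteqP; split=> z [Sz] Cz; split=> //; first by case.
by apply: contrapT => nCz; apply: Cz; split=> //; exact: SK.
Qed.

(** [C] is compact and disjoint from the closed rest of [K], so finitely many basic sets avoiding
    that rest cover [C]. With a countable base, only countably many sets [C] arise. *)
Lemma relatively_clopen_base (I : choiceType) (B : I -> set X) K C :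
    (forall i, open (B i)) ->
    (forall x U, nbhs x U -> exists2 i, B i x & B i `<=` U) ->
    compact K -> relatively_clopen K C ->
  exists s : seq I, C = K `&` \bigcup_(i in [set` s]) B i.
Proof.
move=> oB baseB cK [CK cC cKC].
pose U i := if `[< B i `<=` ~` (K `\` C) >] then B i else set0.
have [|||s Cs] := @compact_seq_cover X I C U.
- exact: subclosed_compact cK CK.
- by move=> i; rewrite /U; case: ifP => // _; exact: open0.
- move=> x Cx; have [|i Bix BiC] := baseB x (~` (K `\` C)).
    by apply: open_nbhs_nbhs; split; [exact: closed_openC|case].
  by exists i => //; rewrite /U asboolT.
exists [seq i <- s | `[< B i `<=` ~` (K `\` C) >]]; apply/seteqP; split=> x.
  move=> Cx; split; first exact: CK.
  have [i /= si] := Cs x Cx; rewrite /U; case: ifP => // Bi Bix.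
  by exists i => //=; rewrite mem_filter Bi.
move=> [Kx [i /=]]; rewrite mem_filter => /andP[/asboolP BiC _] Bix.
by apply: contrapT => nCx; exact: (BiC x Bix).
Qed.

End RelativelyClopen.

(** * Quasi-components and the continuum-connection relation *)

(** A splitting of the quasi-component [Q] extends to disjoint open [U] and [V] by normality. By
    compactness some relatively clopen [P] around [x] lies in their union, and cutting [P] along
    them forces [Q] to one side. *)
Lemma quasicomponent_connected (R : realType) (X : topologicalType)
    (d : X -> X -> R) (K : set X) (x : X) :
  compatible_metric d -> compact K -> K x ->
  connected (\bigcap_(C in [set C | relatively_clopen K C /\ C x]) C).
Proof.
move=> dX cK Kx; set Q := \bigcap_(C in _) C.
have clK : closed K.
  exact: compact_closed (compatible_metric_hausdorff dX) cK.
have cQ : closed Q by apply: closed_bigI => C [[]].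
have QK : Q `<=` K by move=> y; apply; split=> //; exact: relatively_clopenT.
move=> S [b Sb] [W oW SW] [F cF SF].
have [|||U [V [oU oV AU BV UV0]]] :=
    @compatible_metric_normal R X d dX (Q `&` F) (Q `\` W).
- exact: closedI.
- by apply: closedI => //; exact: open_closedC.
- by rewrite -SF SW -subset0 => z [[_ Wz] [_ nWz]].
(* The part of [K] outside [U] and [V] is compact and misses [Q], so finitely many complements of
   the sets defining [Q] cover it. Intersecting those sets gives [P]. *)
have [P [PK Px PUV]] : exists P,
    [/\ relatively_clopen K P, P x & P `<=` U `|` V].
  pose G (C : set X) :=
    if `[< relatively_clopen K C /\ C x >] then ~` C else set0.
  have [|||s Cs] := @compact_seq_cover X (set X) (K `\` (U `|` V)) G.
  - apply: subclosed_compact cK _ => //; apply: closedI => //.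
    by apply: open_closedC; exact: openU.
  - move=> C; rewrite /G; case: asboolP => [[[_ cC _] _]|_].
      exact: closed_openC.
    exact: open0.
  - move=> y [Ky nUV]; apply: contrapT => nG; apply: nUV.
    suff Qy : Q y.
      have [Fy|nFy] := pselect (F y); first by left; exact: AU.
      right; apply: BV; split=> // Wy; apply: nFy.
      by have [] : (Q `&` F) y by rewrite -SF SW.
    move=> C CP; apply: contrapT => nCy; apply: nG.
    by exists C => //; rewrite /G asboolT.
  (* The index set skips entries of [s] that fail the condition; the factor [K] covers the case
     where none remains. *)
  pose P := K `&` \bigcap_(C in [set C |
     C \in s /\ relatively_clopen K C /\ C x]) C.
  exists P; split.
  - rewrite /P; elim: s {Cs P} => [|C s IH].
      by rewrite (_ : _ `&` _ = K); [exact: relatively_clopenT|apply/seteqP;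
        split=> y; [case|move=> Ky; split=> // C []]].
    have [CP|nCP] := pselect (relatively_clopen K C /\ C x).
      suff -> : K `&` \bigcap_(D in [set D | D \in C :: s /\
          relatively_clopen K D /\ D x]) D =
        C `&` (K `&` \bigcap_(D in [set D | D \in s /\
          relatively_clopen K D /\ D x]) D).
        by apply: relatively_clopenI => //; case: CP.
      apply/seteqP; split=> y.
        move=> [Ky CsD]; split; first by apply: CsD; rewrite /= mem_head.
        by split=> // D [Ds DP]; apply: CsD; rewrite /= inE Ds orbT.
      move=> [Cy [Ky sD]]; split=> // D [/=].
      rewrite inE => /orP[/eqP-> //|Ds DP].
      exact: sD.
    suff -> : [set D | D \in C :: s /\ relatively_clopen K D /\ D x] =
        [set D | D \in s /\ relatively_clopen K D /\ D x] by [].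
    apply/seteqP; split=> D [/=] + DP; rewrite inE.
      by move=> /orP[/eqP DC|//]; move: nCP; rewrite -DC.
    by move=> Ds; rewrite Ds orbT.
  - by split=> // C [_ []].
  - move=> y [Ky Py]; apply: contrapT => nUV.
    have [C /= Cs'] := Cs y (conj Ky nUV); rewrite /G.
    by case: asboolP => // CP; apply; apply: Py.
(* [P] meets [U'] in the relatively clopen set [P `\` V']. *)
have sep (U' V' : set X) : open U' -> open V' -> U' `&` V' = set0 ->
    P `<=` U' `|` V' -> U' x -> Q `<=` U'.
  move=> oU' oV' UV' PUV' U'x y Qy.
  have [] // : (P `&` U') y; apply: Qy; split; last by [].
  have [PK' cP cKP] := PK.
  have PUE : P `&` U' = P `\` V'.
    apply/seteqP; split=> z [Pz].
      by move=> U'z; split=> // V'z; rewrite -[False]/(set0 z) -UV'.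
    by have [] := PUV' z Pz.
  split; first by apply: subIset; left.
    by rewrite PUE; apply: closedI => //; exact: open_closedC.
  rewrite setDIr; apply: closedU => //; apply: closedI => //.
  exact: open_closedC.
have Qb : Q b by move: Sb; rewrite SF => -[].
have Ub : U b by apply: AU; rewrite -SF.
(* If [x] lies in [U], so does [Q], and no point of [Q] is outside [W]. If [x] lies in [V], then [b]
   lies in both [U] and [V]. *)
have [Ux|Vx] := PUV x Px.
  have QU := sep U V oU oV UV0 PUV Ux.
  apply/seteqP; split=> y; first by rewrite SF => -[].
  move=> Qy; rewrite SW; split=> //; apply: contrapT => nWy.
  by rewrite -[False]/(set0 y) -UV0; split; [exact: QU|apply: BV].
have QV : Q `<=` V by apply: (sep V U) => //; rewrite 1?setIC // setUC.
by have : set0 b by rewrite -UV0; split=> //; exact: QV.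
Qed.

(** A continuum lies in some [K n] and cannot be cut by a relatively clopen set. Conversely, the
    quasi-component of [x] in [K n] is itself a continuum, and it contains [y]. *)
Lemma continuum_connectionP (R : realType) (X : topologicalType)
    (d : X -> X -> R) (K : nat -> set X) (x y : X) :
    compatible_metric d -> (forall n, compact (K n)) ->
    (forall C, compact C -> exists n, C `<=` K n) ->
  continuum_connection R x y <->
  exists n, [/\ K n x, K n y &
    forall C, relatively_clopen (K n) C -> C x -> C y].
Proof.
move=> dX cK exhK; split.
  move=> [S [[_ /set_type_compactP cS /set_type_connectedP conS _] Sx Sy]].
  have [n SK] := exhK S cS; exists n; split; [exact: SK|exact: SK|] => C CK.
  exact: connected_relatively_clopen SK conS CK Sx Sy.
move=> [n [Kx Ky CP]].
have clK : closed (K n).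
  exact: compact_closed (compatible_metric_hausdorff dX) (cK n).
exists (\bigcap_(C in [set C | relatively_clopen (K n) C /\ C x]) C).
set Q := \bigcap_(C in _) C.
have Qx : Q x by move=> C [].
have Qy : Q y by move=> C [? ?]; exact: CP.
split=> //; split.
- by exists (SigSub (mem_set Qx)).
- apply/set_type_compactP; apply: subclosed_compact (cK n) _.
    by apply: closed_bigI => C [[]].
  by move=> z; apply; split=> //; exact: relatively_clopenT.
- by apply/set_type_connectedP; exact: quasicomponent_connected dX _ _.
- exact: set_type_metrizable dX _.
Qed.

(** * Cylinders and Borel maps into the Cantor space *)

(** The cylinders around [x] generate a filter that converges to [x] in every coordinate, hence in
    the product topology. *)
Lemma nbhs_cantor_NN (x : cantor_NN) (U : set cantor_NN) : nbhs x U ->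
  exists s : seq (nat * nat),
    [set y : cantor_NN | {in s, forall p, y p = x p}] `<=` U.
Proof.
pose F := filter_from [set: seq (nat * nat)]
  (fun s => [set y : cantor_NN | {in s, forall p, y p = x p}]).
have FF : Filter F.
  apply: filter_from_filter; first by exists [::].
  move=> s t _ _; exists (s ++ t) => // y xy.
  by split=> p ps; apply: xy; rewrite mem_cat ps ?orbT.
have Fx : F --> x.
  apply/cvg_sup => p; apply/cvg_image.
    apply/seteqP; split=> // b _; exists (fun=> b) => //.
  move=> A /nbhs_singleton Axp.
  exists ((fun y : cantor_NN => y p) @^-1` A); last first.
    by apply: image_preimage; apply/seteqP; split=> // b _; exists (fun=> b).
  by exists [:: p] => // y /= xy; rewrite /preimage /= xy ?mem_head.
by move=> /Fx [s _ sU]; exists s.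
Qed.

(** Sets with Borel preimage form a sigma-algebra, so open sets suffice. An open set is a countable
    union of cylinders, whose preimages are finite intersections of sets [A p] and their
    complements. *)
Lemma borel_map_cantor_NN (X : topologicalType) (A : nat * nat -> set X) :
  (forall p, borel_set (A p)) ->
  @borel_map X cantor_NN (fun x p => `[< A p x >]).
Proof.
move=> bA; set f := fun x p => _.
have [b0 bC bU] : sigma_algebra setT (@borel_set X).
  exact: smallest_sigma_algebra.
have bTC (B : set X) : borel_set B -> borel_set (~` B).
  by rewrite -setTD; exact: bC.
have bI (B C : set X) : borel_set B -> borel_set C -> borel_set (B `&` C).
  move=> bB bCC; rewrite -[B `&` C]setCK setCI; apply: (bTC).
  have := bU (fun n => if n is 0 then ~` B else ~` C).
  rewrite (_ : \bigcup_n _ = ~` B `|` ~` C).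
    by move=> h; apply: h => -[|n]; exact: bTC.
  apply/seteqP; split=> z; first by move=> [[|n] _]; [left|right].
  by move=> [Bz|Cz]; [exists 0%N|exists 1%N].
suff : <<s @open cantor_NN >> `<=` [set B | borel_set (f @^-1` B)] by [].
apply: smallest_sub.
  split=> /=.
  - by rewrite preimage_set0.
  - by move=> B bB; rewrite setTD preimage_setC; exact: bTC.
  - by move=> B bB; rewrite preimage_bigcup; exact: bU.
move=> U oU /=.
pose cyl (s : seq ((nat * nat) * bool)) :=
  [set y : cantor_NN | {in s, forall pb, y pb.1 = pb.2}].
have bcyl s : borel_set (f @^-1` cyl s).
  elim: s => [|[p b] s IH].
    rewrite (_ : f @^-1` cyl [::] = ~` set0); first exact: bTC.
    by rewrite setC0; apply/seteqP; split.
  rewrite (_ : f @^-1` cyl _ = (if b then A p else ~` A p) `&` f @^-1` cyl s).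
    by apply: bI => //; case: b => //; exact: bTC.
  apply/seteqP; split=> z.
    move=> zs; split; last by move=> q qs; apply: zs; rewrite inE qs orbT.
    have := zs (p, b) (mem_head _ _); rewrite /f /=.
    by case: b {zs} => [/asboolP|/negbT/asboolPn].
  move=> [zb zs] q; rewrite inE => /orP[/eqP->|]; last exact: zs.
  by rewrite /f /=; case: b zb => [/asboolT|/asboolF].
(* Cylinders are coded by finite lists, so those inside [U] are enumerated by [unpickle]; all other
   codes contribute [set0]. *)
have -> : f @^-1` U =
    \bigcup_n oapp
      (fun s => if `[< cyl s `<=` U >] then f @^-1` cyl s else set0) set0
      (unpickle n).
  apply/seteqP; split=> z; last first.
    move=> [n _]; case: unpickle => //= s; case: asboolP => // sU; exact: sU.
  move=> Uz; have [s sU] := nbhs_cantor_NN (open_nbhs_nbhs (conj oU Uz)).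
  pose t := [seq (p, f z p) | p <- s].
  exists (pickle t); first by [].
  cbv beta; rewrite pickleK /= asboolT.
    by move=> _ /mapP[p ps ->].
  move=> y yt; apply: sU => p ps.
  by apply: (yt (p, f z p)); apply/mapP; exists p.
by apply: bU => n; case: unpickle => //= s; case: ifP.
Qed.

(** * The reduction to [E_1] *)

Theorem proposition34 (R : realType) (X : topologicalType)
  (polishX : polish R X) (lcX : locally_compact [set: X]%classic) :
  borel_reducible (@continuum_connection R X) E_1.
Proof.
have [sepX [d [dX _]]] := polishX.
have [B oB baseB] := separable_metric_base dX sepX.
have [K [cK homoK exhK]] := compact_exhaustion oB baseB lcX.
have clK n : closed (K n).
  exact: compact_closed (compatible_metric_hausdorff dX) (cK n).
pose D n (s : seq (nat * nat)) := K n `&` \bigcup_(i in [set` s]) B i.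
(* [A (n, _)] enumerates the relatively clopen subsets of [K n]; codes of
   unions that are not relatively clopen give [set0]. *)
pose A (p : nat * nat) := oapp (fun s =>
  if `[< relatively_clopen (K p.1) (D p.1 s) >] then D p.1 s else set0)
  set0 (unpickle p.2).
have Aclopen n k : relatively_clopen (K n) (A (n, k)).
  rewrite /A; case: unpickle => [s|] /=; last exact: relatively_clopen0.
  by case: asboolP => // _; exact: relatively_clopen0.
have clopenA n C : relatively_clopen (K n) C -> exists k, C = A (n, k).
  move=> CK; have [s CE] := relatively_clopen_base oB baseB (cK n) CK.
  have {}CE : C = D n s by [].
  by exists (pickle s); rewrite /A [unpickle _]pickleK /= -CE asboolT.
exists (fun x p => `[< A p x >]).
  apply: borel_map_cantor_NN => -[n k].
  have [_ cA _] := Aclopen n k.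
  have [_ bC _] : sigma_algebra setT (@borel_set X).
    exact: smallest_sigma_algebra.
  rewrite -[A _]setCK -setTD; apply: bC.
  by apply: sub_sigma_algebra; exact: closed_openC.
have rowP x y n : (forall k, `[< A (n, k) x >] = `[< A (n, k) y >]) <->
    (forall C, relatively_clopen (K n) C -> C x <-> C y).
  split=> [Axy C /clopenA[k ->]|xy k]; last first.
    by apply: asbool_equiv_eq; exact: xy.
  by split=> /asboolP h; apply/asboolP; [rewrite -Axy|rewrite Axy].
move=> x y; rewrite (continuum_connectionP _ _ dX cK exhK); split.
  move=> [m [Kx Ky xy]]; exists m => n mn; apply/rowP => C CK.
  (* The trace of [C] on [K m] is relatively clopen there, so the condition at [m] applies to it. *)
  have SC := relatively_clopen_sub (clK m) (homoK _ _ mn) CK.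
  split=> [Cx|Cy]; first by have [] := xy _ SC (conj Kx Cx).
  (* The condition at [m] only passes from [x] to [y]; the converse comes from applying it to the
     complement in [K m]. *)
  apply: contrapT => nCx.
  have [|_] := xy _ (relatively_clopenD SC); last by apply.
  by split=> // -[].
move=> [m xy].
have [a /(_ x erefl) Kax] := exhK [set x] (compact_set1 (x := x)).
have [b /(_ y erefl) Kby] := exhK [set y] (compact_set1 (x := y)).
(* Points outside [K n] all have the zero row, so equal rows alone do not put [x] and [y] into
   [K n]; the index must also pass the stages [a] and [b] that contain them. *)
pose n := maxn m (maxn a b).
have /rowP xyn := xy n (leq_maxl _ _).
exists n; split.
- by apply: homoK Kax; rewrite /n; lia.
- by apply: homoK Kby; rewrite /n; lia.
- by move=> C CK; have [] := xyn C CK.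
Qed.
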